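(* Let $Y=C[0,1]$ be the set of all real continuous functions on $[0,1]$, equipped with the metric $p(u,w)=\max_{t\in[0,1]}|u(t)-w(t)|$ for $u,w\in Y$. Let $K:[0,1]\times[0,1]\times\mathbb{R}\to\mathbb{R}$ be continuous, let $v\in Y$ be a given function, and let $F:Y\to Y$ be the operator defined by $$Fu(t)=v(t)+\int_{0}^{1}K(t,s,u(s))\,ds .$$ Let $\varphi:\mathbb{R}^{+}\to\mathbb{R}^{+}$ be a function such that $\frac{d\varphi}{dq}\big|_{q=\epsilon}>0$ for each $\epsilon>0$. Suppose there exist $\lambda\in[0,1)$ and $\alpha\in(0,1)$ such that for all $u,w\in Y$ and all $s,t\in[0,1]$, $$\frac{d\varphi}{dq}\bigg|_{q=|K(t,s,u(s))-K(t,s,w(s))|}\leq\lambda\left[\frac{d\varphi}{dq}\bigg|_{q=|u(s)-w(s)|}\right]^{\alpha}\left[\frac{d\varphi}{dq}\bigg|_{q=|u(s)-Fu(s)|}\right]^{1-\alpha}.$$ Then the integral equation $$u(t)=v(t)+\int_{0}^{1}K(t,s,u(s))\,ds,\qquad t\in[0,1],$$ has a unique solution $u$ in $Y$.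
   Context: $\mathbb{R}^{+}=[0,\infty)$. $\frac{d\varphi}{dq}\big|_{q=a}$ denotes the derivative of $\varphi$ at $a$, understood as the one-sided derivative when $a=0$; it is implicitly assumed to exist wherever it is written. $Fu(s)$ denotes the value of the function $Fu$ at $s$. *)

(* Defs.v *)
From HB Require Import structures.
From mathcomp Require Import all_boot all_order all_algebra.
From mathcomp Require Import all_classical all_reals all_analysis.
Import Order.TTheory GRing.Theory Num.Theory.
Import numFieldNormedType.Exports.

Set Implicit Arguments.
Unset Strict Implicit.
Unset Printing Implicit Defensive.

Local Open Scope classical_set_scope.
Local Open Scope ring_scope.

(* Derivatives of functions defined on [0, +oo).  Such a function is represented
   by phi : R -> R, of which only the values on [0, +oo) matter: at a > 0 the
   derivative is the usual two-sided one, at a = 0 it is the limit of the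
   difference quotient from the right.  Both definitions are meant for 0 <= a. *)
Definition derivable_nneg (R : realType) (phi : R -> R) (a : R) : Prop :=
  if 0 < a then derivable phi a 1
  else cvg (h^-1 * (phi (a + h) - phi a) @[h --> 0^'+]).

Definition derive_nneg (R : realType) (phi : R -> R) (a : R) : R :=
  if 0 < a then 'D_1 phi a
  else lim (h^-1 * (phi (a + h) - phi a) @[h --> 0^'+]).

(* An element of C[0,1] is represented by a total function satisfying this
   predicate; two such functions are the same element when they agree on [0,1]. *)
Definition continuous01 (R : realType) (u : R -> R) : Prop :=
  {within `[0, 1], continuous u}.

(* The operator F; for continuous integrands the Lebesgue integral coincides
   with the Riemann integral. *)
Definition integral_op (R : realType) (K : R -> R -> R -> R) (v u : R -> R)
    (t : R) : R :=
  v t + (\int[@lebesgue_measure R]_(s in `[0%R, 1%R]) K t s (u s))%R.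

(* Main.v *)
Require Import Defs.
From mathcomp Require Import all_boot all_order all_algebra.
From mathcomp Require Import all_classical all_reals all_analysis.
From mathcomp Require Import lra.
Import Order.TTheory GRing.Theory Num.Theory.
Import numFieldNormedType.Exports.
Local Open Scope classical_set_scope.
Local Open Scope ring_scope.

(** The contractive condition is so strong that it makes [F] constant.

    Suppose that at some point [s] a continuous [u] satisfies [u s = F u s].
    The last factor of the condition at [s] is then [phi' 0] to the power
    [1 - alpha], whatever the competitor [w] is.
    - With [w = u] the condition reads [phi' 0 <= lambda * phi' 0].  As [phi] is
      nondecreasing, [0 <= phi' 0] ([derive_nneg0_ge0]), hence [phi' 0 = 0].
    - With [w] an arbitrary constant [y], the right-hand side now vanishes, and
      positivity of [phi'] away from [0] leaves only [K t s (u s) = K t s y].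
    So [K t s y] is independent of [y].  If this happens at every [s] then [F u]
    is independent of [u], and the unique solution is the common value [F 0],
    which is continuous because [K] is ([continuous_Rintegral01_joint]).

    What remains is to find, for each single [s], a continuous [u] with
    [u s = F u s] ([exists_pointwise_fixed]).  This is possible because [u s]
    and [F u s] are almost independent: the integral does not see a narrow
    spike.  Let [u_theta] be a spike at [s] of height [M * theta] that gets
    infinitely narrow as [theta] tends to [1] or [-1], so that the integral
    tends to its value at [u = 0].  For [M > |F 0 s|] the difference
    [u_theta s - F u_theta s] changes sign between [-1] and [1], and the
    intermediate value theorem applies. *)

(** * Extending the kernel to the whole space *)

Lemma continuous_pair (T U V : topologicalType) (f : T -> U) (g : T -> V) :
  continuous f -> continuous g -> continuous (fun x => (f x, g x)).
Proof. by move=> fc gc x; exact: cvg_pair (fc x) (gc x). Qed.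

Definition clamp01 {R : realType} (x : R) : R := Num.min 1 (Num.max 0 x).

Lemma clamp01_itv (R : realType) (x : R) : clamp01 x \in `[0, 1].
Proof.
rewrite in_itv/= /clamp01 le_min ge_min lexx ler01 /=.
by rewrite le_max lexx.
Qed.

Lemma clamp01_id (R : realType) (x : R) : x \in `[0, 1] -> clamp01 x = x.
Proof.
rewrite in_itv/= => /andP[x0 x1].
by rewrite /clamp01 (max_idPr x0) (min_idPr x1).
Qed.

Lemma clamp01_continuous (R : realType) : continuous (@clamp01 R).
Proof.
move=> x.
suff : {for x, continuous ((cst 1 : R -> R^o) \min ((cst 0 : R -> R^o) \max id))}.
  by [].
apply: continuous_min; first exact: cvg_cst.
by apply: continuous_max; [exact: cvg_cst|exact: cvg_id].
Qed.

(** Composing with the retraction of the line onto the unit interval in the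
    first two variables turns the relative continuity of [K] into continuity. *)
Lemma continuous_kernel_extension (R : realType) (K : R -> R -> R -> R) :
  {within [set x : R * R * R | x.1.1 \in `[0, 1] /\ x.1.2 \in `[0, 1]],
    continuous (fun x : R * R * R => K x.1.1 x.1.2 x.2)} ->
  exists2 k : R * R * R -> R, continuous k &
    forall t s y, t \in `[0, 1] -> s \in `[0, 1] -> k (t, s, y) = K t s y.
Proof.
move=> hK.
pose g (x : R * R * R) := (clamp01 x.1.1, clamp01 x.1.2, x.2).
exists (fun x => K (clamp01 x.1.1) (clamp01 x.1.2) x.2); last first.
  by move=> t s y t01 s01 /=; rewrite !clamp01_id.
have c1 (x : R * R * R) : clamp01 z.1.1 @[z --> x] --> clamp01 x.1.1.
  apply: (@continuous_comp _ _ _ (fst \o fst) (@clamp01 R)).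
    by apply: continuous_comp; exact: cvg_fst.
  exact: clamp01_continuous.
have c2 (x : R * R * R) : clamp01 z.1.2 @[z --> x] --> clamp01 x.1.2.
  apply: (@continuous_comp _ _ _ (snd \o fst) (@clamp01 R)).
    by apply: continuous_comp; [exact: cvg_fst|exact: cvg_snd].
  exact: clamp01_continuous.
have gc : continuous g.
  apply: continuous_pair; first exact: continuous_pair.
  by move=> x; exact: cvg_snd.
move=> x; move/subspace_continuousP : hK => /(_ (g x)).
move=> /(_ (conj (clamp01_itv _ _) (clamp01_itv _ _))) Kgx.
suff gx : g y @[y --> x] -->
    within [set y : R * R * R | y.1.1 \in `[0, 1] /\ y.1.2 \in `[0, 1]] (nbhs (g x)).
  exact: cvg_comp _ _ gx Kgx.
move=> B nB; apply: (@filterS _ (nbhs x)) (gc x _ nB) => y; apply.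
by split; exact: clamp01_itv.
Qed.

(** * Continuity of integrals depending on a parameter *)

Lemma compact_continuous_bounded (R : realType) (T : topologicalType) (A : set T)
    (f : T -> R) :
  compact A -> continuous f -> exists C, forall x, A x -> `|f x| <= C.
Proof.
move=> cA cf; have /compact_bounded[M [_ Mb]] :=
  continuous_compact (@continuous_subspaceT _ _ A _ cf) cA.
by exists (M + 1) => x Ax; apply: (Mb (M + 1)); [rewrite ltrDl|exists x].
Qed.

(** Dominated convergence with a constant bound.  One exceptional point [p], a
    null set, is allowed: the spikes below do not depend continuously on their
    parameter at their peak. *)
Lemma continuous_Rintegral01 (R : realType) (f : R -> R -> R) (a b p C : R) :
  (forall x, x \in `]a, b[ -> continuous (f x)) ->
  (forall y, y != p -> continuous (f^~ y)) ->
  (forall x y, x \in `]a, b[ -> y \in `[0, 1] -> `|f x y| <= C) ->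
  forall x, x \in `]a, b[ ->
  {for x, continuous (fun x => \int[@lebesgue_measure R]_(y in `[0%R, 1%R]) f x y)%R}.
Proof.
move=> fc1 fc2 fC x xab.
have itg (g : R -> R) : continuous g ->
    lebesgue_measure.-integrable `[0, 1]%classic (EFin \o g).
  move=> gc; apply: continuous_compact_integrable; first exact: segment_compact.
  exact: continuous_subspaceT.
apply: (@continuity_under_integral R _ _ lebesgue_measure f `[0, 1]%classic _ a b
  _ _ (cst C)) => //.
- by move=> z zab; apply: itg; exact: fc1.
- exists [set p]; split => //; first exact: lebesgue_measure_set1.
  move=> y /= /not_implyP[_ ny]; apply: contrapT => yp; apply: ny => z _.
  by apply: fc2; apply/eqP.
- by apply: itg; exact: cst_continuous.
- by move=> z zab; apply: aeW => y y01; exact: fC.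
- exact: mem_set.
Qed.

Lemma continuous_Rintegral01_joint (R : realType) (f : R * R -> R) :
  continuous f ->
  continuous (fun x => \int[@lebesgue_measure R]_(y in `[0%R, 1%R]) f (x, y))%R.
Proof.
move=> fc x.
have [C fC] : exists C : R, forall p : R * R,
    (`[x - 1, x + 1] `*` `[0, 1])%classic p -> `|f p| <= C.
  apply: compact_continuous_bounded => //.
  by apply: compact_setX; exact: segment_compact.
(* There is no exceptional point here, so that any value will do for it. *)
apply: (@continuous_Rintegral01 R (fun x y => f (x, y)) (x - 1) (x + 1) 0 C).
- move=> t _ y; apply: (@continuous_comp _ _ _ (fun y => (t, y)) f); last exact: fc.
  by apply: continuous_pair => ?; [exact: cvg_cst|exact: cvg_id].
- move=> y _ t; apply: (@continuous_comp _ _ _ (fun t => (t, y)) f); last exact: fc.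
  by apply: continuous_pair => ?; [exact: cvg_id|exact: cvg_cst].
- move=> t y tx y01; apply: fC; split => //=.
  exact: subset_itv_oo_cc tx.
- by rewrite in_itv/=; apply/andP; split; lra.
Qed.

(** * Functions that agree with their image at a given point *)

(** The profile [e / (e + |r - s|)] has value [1] at [r = s] and tends to [0]
    elsewhere as the width [e] does.  At width [0], where [0 / 0 = 0], it is
    the zero function, so that each spike is continuous in [r]; continuity in
    [theta] fails only at the peak [r = s]. *)
Definition spike {R : realType} (M s theta r : R) : R :=
  let e := Num.max 0 (1 - `|theta|) in M * theta * (e / (e + `|r - s|)).

Lemma spike_peak (R : realType) (M s theta : R) : `|theta| < 1 ->
  spike M s theta s = M * theta.
Proof.
move=> th1; rewrite /spike subrr normr0 addr0 divff ?mulr1//.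
by rewrite gt_eqF// lt_max subr_gt0 th1 orbT.
Qed.

Lemma spike_vanish (R : realType) (M s theta r : R) : 1 <= `|theta| ->
  spike M s theta r = 0.
Proof.
by move=> th1; rewrite /spike max_l ?subr_le0// mul0r mulr0.
Qed.

Lemma spike_bounded (R : realType) (M s theta r : R) : 0 <= M ->
  `|spike M s theta r| <= M.
Proof.
move=> M0; have [th1|th1] := leP 1 `|theta|.
  by rewrite spike_vanish// normr0.
rewrite /spike; set e := Num.max _ _.
have e0 : 0 < e by rewrite lt_max subr_gt0 th1 orbT.
rewrite !normrM (ger0_norm M0) -mulrA ler_piMr// mulr_ile1// ?(ltW th1)//.
have d0 : 0 < e + `|r - s| by rewrite ltr_wpDr.
by rewrite normfV (gtr0_norm e0) (gtr0_norm d0) ler_pdivrMr// mul1r lerDl.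
Qed.

Lemma spike_continuous (R : realType) (M s theta : R) :
  continuous (spike M s theta).
Proof.
have [th1|th1] := leP 1 `|theta|.
  rewrite (_ : spike M s theta = cst 0); first exact: cst_continuous.
  by apply/funext => r; rewrite spike_vanish.
move=> r; rewrite /spike; set e := Num.max _ _.
have e0 : 0 < e by rewrite lt_max subr_gt0 th1 orbT.
apply: cvgM; first exact: cvg_cst.
apply: cvgM; first exact: cvg_cst.
apply: cvgV; first by rewrite gt_eqF// ltr_wpDr.
apply: cvgD; first exact: cvg_cst.
by apply: cvg_norm; apply: cvgB; [exact: cvg_id|exact: cvg_cst].
Qed.

Lemma spike_continuous_param (R : realType) (M s r : R) : r != s ->
  continuous (fun theta => spike M s theta r).
Proof.
move=> rs theta; rewrite /spike.
have ec : Num.max 0 (1 - `|t|) @[t --> theta] --> Num.max 0 (1 - `|theta|).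
  suff : {for theta, continuous
    ((cst 0 : R -> R^o) \max ((fun t => 1 - `|t|) : R -> R^o))} by [].
  apply: continuous_max; first exact: cvg_cst.
  by apply: cvgB; [exact: cvg_cst|apply: cvg_norm; exact: cvg_id].
apply: cvgM.
  by apply: cvgM; [exact: cvg_cst|exact: cvg_id].
apply: cvgM; first exact: ec.
apply: cvgV.
  by rewrite gt_eqF// ltr_wpDl ?le_max ?lexx// normr_gt0 subr_eq0.
by apply: cvgD; [exact: ec|exact: cvg_cst].
Qed.

(** The intermediate value theorem along [theta], from [-1] to [1].  At both ends
    the spike is the zero function, but the height is still counted as
    [M * theta]: this mismatch gives the gap [G] strictly opposite signs there,
    so its zero lies strictly inside, where the spike does reach its height. *)
Lemma exists_pointwise_fixed (R : realType) (k : R * R -> R) (c s : R) :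
  continuous k -> exists2 u : R -> R, continuous u &
    u s = c + (\int[@lebesgue_measure R]_(r in `[0%R, 1%R]) k (r, u r))%R.
Proof.
move=> kc.
pose J (u : R -> R) := (\int[@lebesgue_measure R]_(r in `[0%R, 1%R]) k (r, u r))%R.
pose M : R := `|c + J (cst 0)| + 1.
have M0 : 0 <= M by rewrite addr_ge0.
have [C kC] : exists C : R, forall x : R * R, (`[0, 1] `*` `[- M, M])%classic x -> `|k x| <= C.
  by apply: compact_continuous_bounded => //; apply: compact_setX; exact: segment_compact.
(* An open interval around [-1, 1], to have continuity at the two ends as well. *)
have Jc (theta : R) : theta \in `]-2, 2[ ->
    {for theta, continuous (fun t => J (spike M s t))}.
  apply: (@continuous_Rintegral01 R (fun t r => k (r, spike M s t r)) _ _ s C).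
  - move=> t _ q; apply: (@continuous_comp _ _ _ (fun r => (r, spike M s t r)) k);
      last exact: kc.
    by apply: continuous_pair; [move=> ?; exact: cvg_id|exact: spike_continuous].
  - move=> q rs t; apply: (@continuous_comp _ _ _ (fun t => (q, spike M s t q)) k);
      last exact: kc.
    apply: continuous_pair; first exact: cst_continuous.
    exact: spike_continuous_param.
  - move=> t q _ q01; apply: kC; split => //=.
    by rewrite in_itv/= -ler_norml spike_bounded.
(* For |theta| < 1 this is u s minus its prescribed value, with u the spike. *)
pose G theta := M * theta - (c + J (spike M s theta)).
have Gc : {within `[-1, 1], continuous G}.
  apply: continuous_in_subspaceT => t; rewrite inE/= in_itv/= => /andP[t1 t2].
  apply: cvgB; first by apply: cvgM; [exact: cvg_cst|exact: cvg_id].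
  apply: cvgD; first exact: cvg_cst.
  by apply: Jc; rewrite in_itv/=; apply/andP; split; lra.
have JE t : 1 <= `|t| -> J (spike M s t) = J (cst 0).
  move=> t1; congr J; apply/funext => r; exact: spike_vanish.
have GN1 : G (-1) < 0.
  rewrite /G JE ?normrN1// /M; have := ler_norm (- (c + J (cst 0))); rewrite normrN; lra.
have G1 : 0 < G 1.
  rewrite /G JE ?normr1// /M; have := ler_norm (c + J (cst 0)); lra.
have [||theta th01 Gth] := @IVT R G (-1) 1 0 _ Gc.
  by lra.
  by rewrite ge_min le_max (ltW GN1) (ltW G1) orbT.
have th1 : `|theta| < 1.
  move: th01; rewrite in_itv/= -ler_norml le_eqVlt => /predU1P[|//].
  case: (ler0P theta) => _ th; move: Gth.
    by rewrite (_ : theta = -1) 1?lt_eqF//; [move/eqP; rewrite lt_eqF|rewrite -th opprK].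
  by rewrite th => /eqP; rewrite gt_eqF.
exists (spike M s theta); first exact: spike_continuous.
by rewrite spike_peak//; apply/eqP; rewrite -subr_eq0; apply/eqP; exact: Gth.
Qed.

(** * The derivative at the origin *)

(** The existence of the one-sided derivative makes [phi] right-continuous at
    [0], so that the mean value theorem applies on [[0, h]] and the difference
    quotients at [0] are nonnegative. *)
Lemma derive_nneg0_ge0 (R : realType) (phi : R -> R) :
  (forall q, 0 <= q -> derivable_nneg phi q) ->
  (forall q, 0 < q -> 0 <= derive_nneg phi q) ->
  0 <= derive_nneg phi 0.
Proof.
move=> dphi phi'.
have := dphi 0 (lexx _); rewrite /derivable_nneg /derive_nneg ltxx => c0.
have d1 q : 0 < q -> derivable phi q 1.
  by move=> q0; have := dphi q (ltW q0); rewrite /derivable_nneg q0.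
have phi0 : phi x @[x --> 0^'+] --> phi 0.
  (* phi h = phi 0 + h * (difference quotient), and the quotient converges. *)
  have idc : (h : R) @[h --> 0^'+] --> (0 : R).
    exact: cvg_within.
  have := cvgD (cvg_cst (phi 0)) (cvgM idc c0).
  rewrite mul0r addr0 => /(_ _ _ _) phiE; apply: cvg_trans phiE; apply: near_eq_cvg.
  near=> h; rewrite -[LHS]/(phi 0 + h * (h^-1 * (phi (0 + h) - phi 0))).
  have h0 : h != 0 by rewrite gt_eqF//; near: h; exact: nbhs_right_gt.
  by rewrite add0r mulrA mulfV// mul1r subrKC.
apply: limr_ge => //; near=> h.
have h0 : 0 < h by near: h; exact: nbhs_right_gt.
rewrite add0r mulr_ge0 ?invr_ge0 ?(ltW h0)// subr_ge0.
apply: (@ger0_derive1_le_cc R phi 0 h) => //; rewrite ?in_itv/= ?lexx ?ltW//.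
- by move=> x; rewrite in_itv/= => /andP[x0 _]; exact: d1.
- move=> x; rewrite in_itv/= => /andP[x0 _].
  by have := phi' x x0; rewrite /derive_nneg x0 derive1E.
- apply/continuous_within_itvP => //; split => //.
  + move=> x; rewrite in_itv/= => /andP[x0 _].
    by apply: differentiable_continuous; apply/derivable1_diffP; exact: d1.
  + apply: cvg_at_left_filter; apply: differentiable_continuous.
    by apply/derivable1_diffP; exact: d1.
Unshelve. all: by end_near. Qed.

(** * The integral equation *)

Theorem theorem3p1 (R : realType) (K : R -> R -> R -> R) (v : R -> R)
  (phi : R -> R)
  (hK : {within [set x : R * R * R | x.1.1 \in `[0, 1] /\ x.1.2 \in `[0, 1]],
          continuous (fun x : R * R * R => K x.1.1 x.1.2 x.2)})
  (hv : continuous01 v)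
  (hphi_ge0 : forall q : R, 0 <= q -> 0 <= phi q)
  (hphi_der : forall q : R, 0 <= q -> derivable_nneg phi q)
  (hphi_pos : forall e : R, 0 < e -> 0 < derive_nneg phi e)
  (hcontr : exists lambda alpha : R,
    [/\ 0 <= lambda < 1, 0 < alpha < 1 &
      forall u w : R -> R, continuous01 u -> continuous01 w ->
      forall s t : R, s \in `[0, 1] -> t \in `[0, 1] ->
        derive_nneg phi `|K t s (u s) - K t s (w s)|
        <= lambda * (derive_nneg phi `|u s - w s|) `^ alpha
             * (derive_nneg phi `|u s - integral_op K v u s|) `^ (1 - alpha)]) :
  exists u : R -> R,
    [/\ continuous01 u,
        forall t : R, t \in `[0, 1] ->
          u t = v t + (\int[@lebesgue_measure R]_(s in `[0%R, 1%R]) K t s (u s))%R &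
        forall w : R -> R, continuous01 w ->
          (forall t : R, t \in `[0, 1] ->
            w t = v t + (\int[@lebesgue_measure R]_(s in `[0%R, 1%R]) K t s (w s))%R) ->
          forall t : R, t \in `[0, 1] -> w t = u t].
Proof.
move: hcontr => [lambda [alpha [/andP[l0 l1] /andP[a0 a1] H]]].
have [k kc kE] := continuous_kernel_extension R K hK.
have fixpt s : s \in `[0, 1] ->
    exists2 u : R -> R, continuous01 u & u s = integral_op K v u s.
  move=> s01.
  have [|u uc us] := exists_pointwise_fixed R (fun p => k (s, p.1, p.2)) (v s) s.
    move=> p; apply: (@continuous_comp _ _ _ (fun p : R * R => (s, p.1, p.2)) k).
      apply: continuous_pair; last by move=> ?; exact: cvg_snd.
      by apply: continuous_pair; [exact: cst_continuous|move=> ?; exact: cvg_fst].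
    exact: kc.
  exists u; first exact: continuous_subspaceT.
  rewrite us /integral_op; congr (_ + _); apply: eq_Rintegral => r.
  by rewrite inE /= => r01; rewrite kE.
have zero01 : 0 \in `[0, 1 : R] by rewrite in_itv/= lexx ler01.
have phi'0 : derive_nneg phi 0 = 0.
  have phi'0_ge0 : 0 <= derive_nneg phi 0.
    by apply: derive_nneg0_ge0 => // q q0; exact/ltW/hphi_pos.
  have [u uc us] := fixpt 0 zero01.
  have := H u u uc uc 0 0 zero01 zero01.
  (* The exponents add up to 1: the inequality becomes phi' 0 <= lambda * phi' 0. *)
  rewrite -us !subrr normr0 -mulrA -powRD ?subrKC ?oner_eq0// powRr1//.
  nra.
have K_cst t s y : t \in `[0, 1] -> s \in `[0, 1] -> K t s y = K t s 0.
  move=> t01 s01; have [u uc us] := fixpt s s01.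
  suff Kus z : K t s (u s) = K t s z by rewrite -!Kus.
  have zc : continuous01 (cst z) by apply: continuous_subspaceT; exact: cst_continuous.
  have := H u (cst z) uc zc s t s01 t01.
  rewrite -us subrr normr0 phi'0 powR0 ?subr_eq0 1?gt_eqF// mulr0.
  apply: contraTeq => Kneq; rewrite -ltNge hphi_pos//.
  by rewrite normr_gt0 subr_eq0.
have Fcst u t : t \in `[0, 1] -> integral_op K v u t = integral_op K v (cst 0) t.
  move=> t01; congr (_ + _); apply: eq_Rintegral => s; rewrite inE/= => s01.
  by rewrite K_cst.
exists (integral_op K v (cst 0)); split.
- pose F0 t := v t + (\int[@lebesgue_measure R]_(s in `[0%R, 1%R]) k (t, s, 0))%R.
  apply: (@subspace_eq_continuous _ _ _ F0).
    move=> t; rewrite inE /= => t01; congr (_ + _); apply: eq_Rintegral => s.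
    by rewrite inE /= => s01; rewrite kE.
  apply/subspace_continuousP => t t01; apply: cvgD.
    by move/subspace_continuousP : hv; exact.
  apply: cvg_within_filter.
  apply: (continuous_Rintegral01_joint R (fun p => k (p.1, p.2, 0))) => p.
  apply: (@continuous_comp _ _ _ (fun p : R * R => (p.1, p.2, 0)) k); last exact: kc.
  apply: continuous_pair; last exact: cst_continuous.
  by apply: continuous_pair => ?; [exact: cvg_fst|exact: cvg_snd].
- by move=> t t01; rewrite -[RHS]/(integral_op K v _ t) [RHS]Fcst.
- by move=> w _ wF t t01; rewrite wF//; exact: Fcst.
Qed.
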